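(* Let $G$ be a finite undirected graph (possibly with loops and multiple edges) with nonempty vertex set $V$ and edge set $E$, and let $b\in\mathbb{R}^V$ have all entries nonnegative. Let $u$ and $w$ be distinct vertices of the polytope $\mathcal{P}(G,b)$. Then $u$ and $w$ are the vertices of an edge of $\mathcal{P}(G,b)$ if and only if $\mathrm{gr}(u)\cup\mathrm{gr}(w)$ has a component $C$ such that each component of $\mathrm{gr}(u)\cup\mathrm{gr}(w)$ other than $C$ either is acyclic or else contains exactly one cycle with that cycle having odd length, while the cycle content of $C$ is one of the following: (a) exactly one cycle, with that cycle having even length; or (b) exactly two cycles, with at least one of those cycles having odd length; or (c) exactly one even-length and exactly two odd-length cycles, with any two of those cycles sharing at least one edge.
   Context: $\delta_G(v)$ denotes the set of edges of $G$ incident with $v$; a loop at $v$ appears once in $\delta_G(v)$. $\mathcal{P}(G,b)=\{x\in\mathbb{R}^E \mid x_e\ge 0 \text{ for each } e\in E,\ \sum_{e\in\delta_G(v)}x_e=b_v \text{ for each } v\in V\}$. An edge of a polytope is a one-dimensional face. For $x\in\mathcal{P}(G,b)$, the graph $\mathrm{gr}(x)$ of $x$ is the spanning subgraph of $G$ (vertex set $V$) with edge set $\{e\in E\mid x_e>0\}$. The union of spanning subgraphs of $G$ is the spanning subgraph whose edge set is the union of their edge sets. A cycle of length 1 is a vertex together with a loop attached to it, and a cycle of length 2 is two distinct vertices together with two distinct edges connecting them. *)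

(* Defs.v *)
From mathcomp Require Import classical_sets reals.
From mathcomp Require Import all_boot all_order all_algebra.

Set Implicit Arguments.
Unset Strict Implicit.
Unset Printing Implicit Defensive.

Import Order.TTheory GRing.Theory Num.Theory.
Local Open Scope ring_scope.

(* A finite undirected graph, loops and parallel edges allowed: every edge has
   a set of one (loop) or two endpoints. *)
Record multigraph (V E : finType) := Multigraph {
  ends : E -> {set V};
  card_ends : forall e, (0 < #|ends e| <= 2)%N
}.

Section Graph.
Variables (V E : finType) (G : multigraph V E).

(* [ends G e] being a set, a loop at v is counted once. *)
Definition delta (v : V) : {set E} := [set e | v \in ends G e].

(* A spanning subgraph of G has vertex set V, so it is represented by its edge
   set H : {set E}. *)
Definition adjacent (H : {set E}) : rel V :=
  fun v w => [exists e in H, ends G e == [set v; w]].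

(* Components are represented by their vertex sets. *)
Definition components (H : {set E}) : {set {set V}} :=
  equivalence_partition (connect (adjacent H)) [set: V].

Definition component_edges (H : {set E}) (C : {set V}) : {set E} :=
  [set e in H | ends G e \subset C].

(* A cycle is represented by its edge set D, which determines its vertices; its
   length is k = #|D|.  The edges are e_0, ..., e_(k-1), with e_i joining v_i
   and v_(i+1 mod k), for distinct vertices v_0, ..., v_(k-1).  For k = 1 this
   says that e_0 is a loop at v_0, and for k = 2 that e_0 and e_1 are distinct
   edges connecting the distinct vertices v_0 and v_1. *)
Definition is_cycle (D : {set E}) : bool :=
  (0 < #|D|)%N &&
  [exists v : {ffun 'I_#|D| -> V}, [exists e : {ffun 'I_#|D| -> E},
    [&& injectiveb v, injectiveb e, [set e i | i : 'I_#|D|] == D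
      & [forall i, ends G (e i) == [set v i; v (ordS i)]]]]].

Definition cycles (F : {set E}) : {set {set E}} :=
  [set D | is_cycle D & D \subset F].

Definition odd_cycles (F : {set E}) : {set {set E}} :=
  [set D in cycles F | odd #|D|].

Definition even_cycles (F : {set E}) : {set {set E}} :=
  [set D in cycles F | ~~ odd #|D|].

Definition acyclic (F : {set E}) : Prop := #|cycles F| = 0%N.

Definition one_cycle_odd (F : {set E}) : Prop :=
  #|cycles F| = 1%N /\ (forall D, D \in cycles F -> odd #|D|).

Definition one_cycle_even (F : {set E}) : Prop :=
  #|cycles F| = 1%N /\ (forall D, D \in cycles F -> ~~ odd #|D|).

Definition two_cycles_some_odd (F : {set E}) : Prop :=
  #|cycles F| = 2 /\ (exists2 D, D \in cycles F & odd #|D|).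

Definition one_even_two_odd_sharing (F : {set E}) : Prop :=
  [/\ #|even_cycles F| = 1%N, #|odd_cycles F| = 2
    & forall D D', D \in cycles F -> D' \in cycles F -> D != D' ->
        ~~ [disjoint D & D']].

End Graph.

Section Polyhedra.
Variables (R : realType) (E : finType).
Notation vec := {ffun E -> R^o}.

(* Faces are the sets of maximizers of valid inequalities; c = 0 gives P
   itself (a = 0) and the empty face (a = 1). *)
Definition is_face (P F : set vec) : Prop :=
  exists (c : vec) (a : R),
    (forall x, P x -> \sum_e c e * x e <= a) /\
    F = [set x | P x /\ \sum_e c e * x e = a]%classic.

(* d is the dimension of the affine hull of the nonempty set A, that is, of the
   smallest linear subspace U containing all differences of points of A. *)
Definition has_dim (A : set vec) (d : nat) : Prop :=
  (exists x, A x) /\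
  exists U : {vspace vec},
    [/\ forall x y, A x -> A y -> x - y \in U,
        forall W : {vspace vec},
          (forall x y, A x -> A y -> x - y \in W) -> (U <= W)%VS
      & \dim U = d].

Definition is_vertex (P : set vec) (x : vec) : Prop :=
  is_face P [set x]%classic.

Definition is_edge (P F : set vec) : Prop := is_face P F /\ has_dim F 1.

Definition vertices_of_edge (P : set vec) (u w : vec) : Prop :=
  exists2 F, is_edge P F & forall x, is_vertex F x <-> x = u \/ x = w.

End Polyhedra.

Definition polytope (R : realType) (V E : finType) (G : multigraph V E)
    (b : V -> R) : set {ffun E -> R^o} :=
  [set x | (forall e, 0 <= x e) /\
           (forall v, \sum_(e in delta G v) x e = b v)]%classic.

Definition gr (R : realType) (E : finType) (x : {ffun E -> R^o}) : {set E} :=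
  [set e | 0 < x e].

(* Main.v *)
Require Import Defs.
From mathcomp Require Import classical_sets reals.
From mathcomp Require Import all_boot all_order all_algebra.
From mathcomp Require Import ring lra.
From mathcomp Require mxabelem.
Set Implicit Arguments.
Unset Strict Implicit.
Unset Printing Implicit Defensive.
Import Order.TTheory GRing.Theory Num.Theory.

(* Let H = gr u :|: gr w.  The smallest face containing u and w consists of the
   points supported in H, so u and w are adjacent iff the space of vectors
   supported in H with zero sum at every vertex is the line spanned by u - w.
   This space is the direct sum of its analogues for the components of H, and
   the dimension of a summand is compared with that of the cycle space Z over
   F_2 of the component (C, F): both are null spaces of incidence matrices, so
   each dimension minus #|F| - #|C| is the dimension of the null space of the
   transpose, which is 1 over F_2, and over R is 1 or 0 according to whether the
   component is bipartite, that is, to whether all members of Z have even size.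
   Cycles are the minimal nonempty members of Z, and a family closed under
   symmetric difference with few minimal members, or with at most four members,
   is easily described. *)

(** * Symmetric differences of finite sets *)

Section SymmetricDifference.
Variable T : finType.
Implicit Types A B : {set T}.

Definition symdiff A B : {set T} := (A :\: B) :|: (B :\: A).

Lemma in_symdiff A B x : (x \in symdiff A B) = (x \in A) (+) (x \in B).
Proof. by rewrite !inE; case: (x \in A); case: (x \in B). Qed.

Lemma symdiff_eq0 A B : (symdiff A B == set0) = (A == B).
Proof.
apply/eqP/eqP => [/setP AB|->]; apply/setP => e.
  by have := AB e; rewrite in_symdiff inE; case: (e \in A); case: (e \in B).
by rewrite in_symdiff inE addbb.
Qed.

Lemma symdiff_setD A B : A \subset B -> symdiff A B = B :\: A.
Proof. by rewrite /symdiff -setD_eq0 => /eqP->; rewrite set0U. Qed.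

Lemma symdiff_disjoint A B :
  (B \subset symdiff A B) = [disjoint A & B].
Proof.
rewrite disjoint_sym -setI_eq0; apply/subsetP/eqP => [sB|/setP dB e eB].
  apply/setP => e; rewrite !inE; apply/negP => /andP[eB eA].
  by have := sB e eB; rewrite in_symdiff eA eB.
by have := dB e; rewrite in_symdiff !inE eB /= => ->.
Qed.

Lemma symdiffC A B : symdiff A B = symdiff B A.
Proof. by rewrite /symdiff setUC. Qed.

Lemma symdiffK A B : symdiff A (symdiff A B) = B.
Proof. by apply/setP => e; rewrite !in_symdiff addbA addbb. Qed.

Lemma odd_symdiff A B : odd #|symdiff A B| = odd #|A| (+) odd #|B|.
Proof.
rewrite cardsU (_ : _ :&: _ = set0) ?cards0 ?subn0; last first.
  by apply/setP => e; rewrite !inE; case: (e \in A); case: (e \in B).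
rewrite oddD -(cardsID B A) -(cardsID A B) !oddD setIC.
by case: (odd _); case: (odd _); case: (odd _).
Qed.

End SymmetricDifference.

(** * Families closed under symmetric difference and their minimal nonempty members *)

Section MinimalSets.
Variables (E : finType) (Z cyc : {set {set E}}).
Hypothesis Z0 : set0 \in Z.
Hypothesis Z_symdiff : forall A B : {set E}, A \in Z -> B \in Z -> symdiff A B \in Z.
Hypothesis cyc_Z : {subset cyc <= Z}.
Hypothesis cyc_neq0 : set0 \notin cyc.
Hypothesis cyc_min : forall A D : {set E},
  A \in cyc -> D \in Z -> D \subset A -> D != set0 -> D = A.
Hypothesis Z_cyc : forall D : {set E},
  D \in Z -> D != set0 -> exists2 A, A \in cyc & A \subset D.

Lemma Z_setD (A B : {set E}) : A \in Z -> B \in Z -> A \subset B -> B :\: A \in Z.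
Proof. by move=> ZA ZB sAB; rewrite -symdiff_setD // Z_symdiff. Qed.

Lemma cyc_neq (A : {set E}) : A \in cyc -> A != set0.
Proof. by move=> cA; apply: contraNneq cyc_neq0 => <-. Qed.

(** The difference [D :\: A] is again in [Z], so if it were nonempty it would contain a further
    minimal member. *)
Lemma eq_cyc (A D : {set E}) : D \in Z -> A \in cyc -> A \subset D ->
  (forall B, B \in cyc -> B \subset D :\: A -> False) -> D = A.
Proof.
move=> ZD cA sAD none; apply/eqP; rewrite eqEsubset sAD andbT -setD_eq0.
apply/negPn/negP => /(Z_cyc (Z_setD (cyc_Z cA) ZD sAD))[B cB].
exact: none.
Qed.

Lemma cyc_sub (A B : {set E}) : A \in cyc -> B \in cyc -> A \subset B -> A = B.
Proof. by move=> cA cB sAB; apply: cyc_min => //; [exact: cyc_Z|exact: cyc_neq]. Qed.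

Lemma sub_setD_disjoint (A B D : {set E}) : B \subset D :\: A -> [disjoint A & B].
Proof. by rewrite subsetD disjoint_sym => /andP[]. Qed.

Lemma card_minimal0 : #|cyc| = 0 <-> #|Z| = 1.
Proof.
split=> [/cards0_eq cyc0|/eqP/cards1P[D ZD]].
  apply/eqP/cards1P; exists set0; apply/setP => D; rewrite inE.
  apply/idP/eqP => [ZD|->//]; apply/eqP/negPn/negP => /(Z_cyc ZD)[A].
  by rewrite cyc0 inE.
apply/eqP; rewrite cards_eq0 -subset0; apply/subsetP => A cA.
have D0 : set0 = D by apply/set1P; rewrite -ZD.
have /cyc_Z := cA; rewrite ZD -D0 => /set1P A0.
by have := cyc_neq cA; rewrite A0 eqxx.
Qed.

Lemma cyc1_Z (A : {set E}) : cyc = [set A] -> Z = [set set0; A].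
Proof.
move=> cyc1; have cA : A \in cyc by rewrite cyc1 set11.
apply/setP => D; rewrite in_set2; apply/idP/orP => [ZD|[]/eqP->//]; last exact: cyc_Z.
case: (eqVneq D set0) => [|D0]; [by left|right; apply/eqP].
have [B] := Z_cyc ZD D0; rewrite cyc1 => /set1P-> sAD.
apply: eq_cyc => // B'; rewrite cyc1 => /set1P-> /sub_setD_disjoint.
by rewrite -setI_eq0 setIid; apply/negP/cyc_neq.
Qed.

Lemma cards2_set0 (A : {set E}) : A != set0 -> #|[set set0; A]| = 2.
Proof. by move=> A0; rewrite cards2 eq_sym A0. Qed.

Lemma card_minimal1 : #|cyc| = 1 <-> #|Z| = 2.
Proof.
split=> [/eqP/cards1P[A cyc1]|Z2].
  by rewrite (cyc1_Z cyc1) cards2_set0 // cyc_neq // cyc1 set11.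
have [A A0 ZA] : exists2 A, A != set0 & Z = [set set0; A].
  have [A] : exists A, A \in Z :\ set0.
    apply/set0Pn; rewrite -card_gt0; move: Z2.
    by rewrite (cardsD1 set0) Z0 add1n => -[->].
  rewrite !inE => /andP[A0 AZ]; exists A => //; apply/eqP.
  rewrite eq_sym eqEcard cards2_set0 // Z2 leqnn andbT.
  by apply/subsetP => B /set2P[]->.
apply/eqP/cards1P; exists A; apply/setP => B; rewrite inE.
apply/idP/eqP => [cB|->].
  by have := cyc_Z cB; rewrite ZA => /set2P[B0|//]; have := cyc_neq cB; rewrite B0 eqxx.
have [||W cW sWA] := @Z_cyc A; [by rewrite ZA set22|by []|].
by have := cyc_Z cW; rewrite ZA => /set2P[W0|<-//]; have := cyc_neq cW; rewrite W0 eqxx.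
Qed.

(** The symmetric difference is a nonempty member of [Z], so it contains [A] or [B]; either
    inclusion forces disjointness. *)
Lemma cyc2_disjoint (A B : {set E}) : A != B -> cyc = [set A; B] -> [disjoint A & B].
Proof.
move=> AB cycAB.
have cA : A \in cyc by rewrite cycAB set21.
have cB : B \in cyc by rewrite cycAB set22.
have [||D] := @Z_cyc (symdiff A B); rewrite ?symdiff_eq0 ?Z_symdiff ?cyc_Z //.
rewrite cycAB => /set2P[]->; last by rewrite symdiff_disjoint.
by rewrite symdiffC symdiff_disjoint disjoint_sym.
Qed.

Definition span2 (A B : {set E}) := [set set0; A; B; symdiff A B].

Lemma card_span2 (A B : {set E}) : A != set0 -> B != set0 -> A != B ->
  #|span2 A B| = 4.
Proof.
move=> A0 B0 AB; rewrite /span2 -!setUA !cardsU1 cards1 !inE.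
rewrite ![set0 == _]eq_sym symdiff_eq0 (negPf A0) (negPf B0) (negPf AB) /=.
have -> : (A == symdiff A B) = false.
  by rewrite -symdiff_eq0 symdiffK (negPf B0).
by rewrite -symdiff_eq0 [symdiff A B]symdiffC symdiffK (negPf A0).
Qed.

(** A nonempty member containing just one of the disjoint sets [A] and [B] equals that set by
    [eq_cyc]; one containing both is their disjoint union, which is [symdiff A B]. *)
Lemma cyc2_Z (A B : {set E}) : A != B -> cyc = [set A; B] -> Z = span2 A B.
Proof.
move=> AB cycAB; have dAB := cyc2_disjoint AB cycAB.
have cA : A \in cyc by rewrite cycAB set21.
have cB : B \in cyc by rewrite cycAB set22.
have none (X D : {set E}) : X \in cyc -> X \subset D :\: X -> False.
  by move=> cX /sub_setD_disjoint; rewrite -setI_eq0 setIid; apply/negP/cyc_neq.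
apply/eqP; rewrite eqEsubset; apply/andP; split; apply/subsetP => D; last first.
  rewrite !inE => /orP[/orP[/orP[]|]|] /eqP-> //; try exact: cyc_Z.
  by rewrite Z_symdiff // cyc_Z.
have one (X Y D' : {set E}) : cyc = [set X; Y] -> D' \in Z -> X \subset D' ->
    ~~ (Y \subset D' :\: X) -> D' = X.
  move=> cycXY ZD' sX nY; have cX : X \in cyc by rewrite cycXY set21.
  apply: eq_cyc => // W; rewrite cycXY => /set2P[]-> ; first exact: none.
  exact/negP.
move=> ZD; rewrite /span2 !inE.
case: (eqVneq D set0) => //= D0.
case: (boolP (A \subset D)) => sA; last first.
  have [W] := Z_cyc ZD D0; rewrite cycAB => /set2P[]->; first by rewrite (negPf sA).
  move=> sB; rewrite (one B A D) ?eqxx ?orbT //; first by rewrite setUC.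
  by apply: contra sA => /subset_trans->//; exact: subsetDl.
case: (boolP (B \subset D :\: A)) => sB; last by rewrite (one A B D) ?eqxx.
have ZDA := Z_setD (cyc_Z cA) ZD sA.
have DAB : D :\: A = B.
  apply: (one B A) => //; first by rewrite setUC.
  apply/negP => sA'; apply: (none A D cA); apply: subset_trans sA' _.
  exact: subsetDl.
have DE : D = symdiff A B by rewrite -DAB -symdiff_setD // symdiffK.
by rewrite DE eqxx !orbT.
Qed.

(** If [D] contains the minimal member [A], a minimal member inside [D :\: A] would be disjoint from
    [A]; hence [D] is [A] itself. *)
Lemma cyc3_Z : (forall A B, A \in cyc -> B \in cyc -> A != B -> ~~ [disjoint A & B]) ->
  Z = set0 |: cyc.
Proof.
move=> sharing; apply/setP => D; rewrite !inE.
apply/idP/orP => [ZD|[/eqP->//|]]; last exact: cyc_Z.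
case: (eqVneq D set0) => [|D0]; [by left|right].
have [A cA sA] := Z_cyc ZD D0; rewrite (@eq_cyc A D) // => B cB /sub_setD_disjoint dAB.
case: (eqVneq A B) dAB => [<-|/(sharing _ _ cA cB)/negPf->//].
by rewrite -setI_eq0 setIid; apply/negP/cyc_neq.
Qed.

(** A family of four sets is [span2 A B] for any two of its minimal members. If these are disjoint,
    their symmetric difference contains them and is not minimal; otherwise all three nonempty
    members are minimal, and additivity of parity makes exactly two of them odd. *)
Lemma card_minimal_odd :
  #|Z| = 4 /\ (exists2 D, D \in Z & odd #|D|) <->
  (#|cyc| = 2 /\ exists2 D, D \in cyc & odd #|D|) \/
  [/\ #|[set D in cyc | ~~ odd #|D|]| = 1, #|[set D in cyc | odd #|D|]| = 2
    & forall D D', D \in cyc -> D' \in cyc -> D != D' -> ~~ [disjoint D & D']].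
Proof.
split=> [[Z4 [D ZD oddD]]|].
- have cyc_gt1 : 1 < #|cyc|.
    case c: #|cyc| => [|[|//]].
      by have := card_minimal0.1 c; rewrite Z4.
    by have := card_minimal1.1 c; rewrite Z4.
  have [A [B [cA cB AB]]] := card_gt1P cyc_gt1.
  have A0 := cyc_neq cA; have B0 := cyc_neq cB.
  have ZAB : Z = span2 A B.
    apply/eqP; rewrite eq_sym eqEcard card_span2 // Z4 leqnn andbT.
    apply/subsetP => X; rewrite !inE => /orP[/orP[/orP[]|]|] /eqP-> //; try exact: cyc_Z.
    by rewrite Z_symdiff // cyc_Z.
  have cycP X : X \in cyc -> X \in [set A; B; symdiff A B].
    by move=> cX; have := cyc_Z cX; rewrite ZAB !inE (negPf (cyc_neq cX)).
  (* If the given odd member is [symdiff A B], additivity of parity makes one of [A] and [B] odd. *)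
  have odd3 : odd #|A| || odd #|B|.
    move: ZD oddD; rewrite ZAB !inE => /orP[/orP[/orP[]|]|] /eqP->;
      rewrite ?cards0 // ?odd_symdiff.
    - by move->.
    - by move->; rewrite orbT.
    - by case: (odd _).
  have ASB : (A == symdiff A B) = false by rewrite -symdiff_eq0 symdiffK (negPf B0).
  have BSB : (B == symdiff A B) = false.
    by rewrite -symdiff_eq0 [symdiff A B]symdiffC symdiffK (negPf A0).
  case: (boolP [disjoint A & B]) => dAB; [left|right].
    suff -> : cyc = [set A; B].
      rewrite cards2 AB; split=> //.
      by case/orP: odd3 => o; [exists A; rewrite ?set21|exists B; rewrite ?set22].
    apply/setP => X; apply/idP/idP => [cX|/set2P[]->//].
    have := cycP X cX; rewrite in_setU => /orP[//|/set1P XS].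
    have : B \subset X by rewrite XS symdiff_disjoint.
    by move/(cyc_sub cB cX) => BX; rewrite -BX set22.
  have cS : symdiff A B \in cyc.
    have [||W cW sW] := @Z_cyc (symdiff A B); rewrite ?symdiff_eq0 ?Z_symdiff ?cyc_Z //.
    have := cycP W cW; rewrite !inE => /orP[/orP[]|] /eqP WE; last by rewrite -WE.
      by move: sW; rewrite WE symdiffC symdiff_disjoint disjoint_sym (negPf dAB).
    by move: sW; rewrite WE symdiff_disjoint (negPf dAB).
  have cycE : cyc = [set A; B; symdiff A B].
    by apply/setP => X; apply/idP/idP => [/cycP//|]; rewrite !inE => /orP[/orP[]|] /eqP->.
  (* Disjointness would amount to [symdiff A B \subset B], against minimality of [B]. *)
  have nAS : ~~ [disjoint A & symdiff A B].
    by rewrite -symdiff_disjoint symdiffK; apply/negP => /(cyc_sub cS cB)/eqP;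
      rewrite eq_sym BSB.
  have nBS : ~~ [disjoint B & symdiff A B].
    rewrite -symdiff_disjoint [symdiff A B]symdiffC symdiffK.
    by rewrite symdiffC; apply/negP => /(cyc_sub cS cA)/eqP; rewrite eq_sym ASB.
  have cardE (P : pred {set E}) :
      #|[set X in cyc | P X]| = P A + P B + P (symdiff A B).
    rewrite cycE -sum1dep_card -!setUA.
    rewrite (eq_bigl (fun X => (X \in A |: (B |: [set symdiff A B])) && P X));
      last by move=> X; rewrite inE.
    rewrite big_mkcondr /= !big_setU1 ?inE ?(negPf AB) ?ASB ?BSB //= big_set1.
    by rewrite addnA; case: (P A); case: (P B); case: (P _).
  split.
  - by rewrite cardE odd_symdiff; move: odd3; case: (odd _); case: (odd _).
  - by rewrite cardE odd_symdiff; move: odd3; case: (odd _); case: (odd _).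
  - move=> X Y; rewrite cycE !inE.
    move=> /orP[/orP[]|] /eqP-> /orP[/orP[]|] /eqP->; rewrite ?eqxx // => _;
      by rewrite // disjoint_sym.
case=> [[/eqP/cards2P[A [B [AB cycAB]]] [D cD oddD]]|[c1 c2 sharing]].
- split; last by exists D => //; exact: cyc_Z.
  by rewrite (cyc2_Z AB cycAB) card_span2 // cyc_neq // cycAB ?set21 ?set22.
- split.
    rewrite (cyc3_Z sharing) cardsU1 cyc_neq0.
    rewrite -(cardsID [set D : {set E} | odd #|D|] cyc).
    have -> : cyc :&: [set D : {set E} | odd #|D|] = [set D in cyc | odd #|D|].
      by apply/setP => D; rewrite !inE.
    have -> : cyc :\: [set D : {set E} | odd #|D|] = [set D in cyc | ~~ odd #|D|].
      by apply/setP => D; rewrite !inE andbC.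
    by rewrite c1 c2.
  have : 0 < #|[set D in cyc | odd #|D|]| by rewrite c2.
  by case/card_gt0P => D; rewrite inE => /andP[cD oD]; exists D => //; exact: cyc_Z.
Qed.

End MinimalSets.

Local Open Scope ring_scope.

(** * Null vectors of submatrices, with rows and columns indexed by finite sets *)

Section SubMatrix.
Variables (K : fieldType) (I J : finType) (F : {set I}) (C : {set J}).
Variable a : I -> J -> K.

(** Rows are indexed by [F], so [kermx] gives the vectors on [F] that satisfy one equation for each
    member of [C]. *)
Definition submatrix : 'M[K]_(#|F|, #|C|) :=
  \matrix_(i, j) a (enum_val i) (enum_val j).

(* Only the values of [x] on [F] matter. *)
Definition null (x : I -> K) : Prop :=
  forall j, j \in C -> \sum_(i in F) x i * a i j = 0.

Definition restr (x : I -> K) : 'rV[K]_#|F| := \row_i x (enum_val i).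

(** The sum has one term if [i] lies in [F] and none otherwise, so this is extension by zero. *)
Definition extend (r : 'rV[K]_#|F|) (i : I) : K :=
  \sum_(k | enum_val k == i) r 0 k.

Lemma extendK r : restr (extend r) = r.
Proof.
apply/rowP => k; rewrite mxE /extend (big_pred1 k) // => l.
by rewrite /= (inj_eq enum_val_inj).
Qed.

Lemma restr_inj x y : restr x = restr y -> {in F, x =1 y}.
Proof.
move=> /rowP exy i iF; have := exy (enum_rank_in iF i).
by rewrite !mxE enum_rankK_in.
Qed.

Lemma nullP x : null x <-> restr x *m submatrix = 0.
Proof.
have E j : (restr x *m submatrix) 0 j = \sum_(i in F) x i * a i (enum_val j).
  by rewrite mxE [RHS]big_enum_val; apply: eq_bigr => i _; rewrite !mxE.
split=> [Nx|/rowP Nx j jC].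
  by apply/rowP => j; rewrite E mxE Nx ?enum_valP.
by have := Nx (enum_rank_in jC j); rewrite E mxE enum_rankK_in.
Qed.

Lemma rank_ker0 :
  \rank (kermx submatrix) = 0%N <-> forall x, null x -> {in F, forall i, x i = 0}.
Proof.
split=> [/eqP|N0].
  rewrite mxrank_eq0 => /eqP k0 x /nullP/eqP.
  rewrite -sub_kermx k0 submx0 => /eqP x0; apply: (@restr_inj x (fun=> 0)).
  by rewrite x0; apply/rowP => k; rewrite !mxE.
apply/eqP; rewrite mxrank_eq0; apply/eqP/row_matrixP => k.
rewrite row0 -(extendK (row k _)).
apply/rowP => l; rewrite !mxE; apply: N0; last exact: enum_valP.
by apply/nullP; rewrite extendK; apply/eqP; rewrite -sub_kermx row_sub.
Qed.

Lemma rank_ker1 :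
  \rank (kermx submatrix) = 1%N <->
  exists x, [/\ null x, exists2 i, i \in F & x i != 0
    & forall y, null y -> exists c, {in F, forall i, y i = c * x i}].
Proof.
split=> [rk1|[x [/nullP/eqP Nx [i iF xi] gen]]].
  set r := nz_row (kermx submatrix).
  have k0 : kermx submatrix != 0 by rewrite -mxrank_eq0 rk1.
  have rsub : (r <= kermx submatrix)%MS by exact: nz_row_sub.
  have rr : \rank r = 1%N by rewrite rank_rV nz_row_eq0 k0.
  have ksub : (kermx submatrix <= r)%MS.
    by rewrite -(geq_leqif (mxrank_leqif_sup rsub)) rk1 rr.
  exists (extend r); split.
  - by apply/nullP; rewrite extendK; apply/eqP; rewrite -sub_kermx.
  - have : r != 0 by rewrite nz_row_eq0.
    case/rV0Pn => k rk; exists (enum_val k); first exact: enum_valP.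
    by rewrite -{1}(extendK r) mxE in rk.
  - move=> y /nullP/eqP; rewrite -sub_kermx => /submx_trans/(_ ksub).
    case/sub_rVP => c yc; exists c; apply: restr_inj.
    by rewrite yc -{1}(extendK r); apply/rowP => k; rewrite !mxE.
rewrite -sub_kermx in Nx.
have rx : \rank (restr x) = 1%N.
  rewrite rank_rV; case: eqP => // /rowP/(_ (enum_rank_in iF i)).
  by rewrite !mxE enum_rankK_in // => x0; rewrite x0 eqxx in xi.
rewrite -rx; apply: eqmx_rank; apply/andP; split=> //.
apply/row_subP => k; rewrite -(extendK (row k _)).
have /gen[c yc] : null (extend (row k (kermx submatrix))).
  by apply/nullP; rewrite extendK; apply/eqP; rewrite -sub_kermx row_sub.
apply/sub_rVP; exists c; apply/rowP => l; rewrite ![in RHS]mxE -yc ?enum_valP //.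
by rewrite mxE.
Qed.

End SubMatrix.

Section RankNullity.
Variables (K : fieldType) (I J : finType) (F : {set I}) (C : {set J}).
Variable a : I -> J -> K.

(** Both sides are [#|F| + #|C|] minus the common rank of the matrix and its transpose. *)
Lemma rank_nullity :
  (\rank (kermx (submatrix F C a)) + #|C|
   = \rank (kermx (submatrix C F (fun j i => a i j))) + #|F|)%N.
Proof.
have -> : submatrix C F (fun j i => a i j) = (submatrix F C a)^T.
  by apply/matrixP => i j; rewrite !mxE.
rewrite !mxrank_ker mxrank_tr.
have := rank_leq_row (submatrix F C a); have := rank_leq_col (submatrix F C a).
by move=> rC rF; rewrite addnBAC // addnBAC // addnC.
Qed.

End RankNullity.

Lemma F2P (x : 'F_2) : x = (x == 1)%:R.
Proof. by case: x => -[|[|//]] lt; apply: val_inj. Qed.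

Lemma natF2_odd n : n%:R = (odd n)%:R :> 'F_2.
Proof.
rewrite -[n in LHS]odd_double_half natrD -mul2n natrM (_ : 2%:R = 0).
  by rewrite mul0r addr0.
exact: val_inj.
Qed.

(** * Null vectors over the two-element field, viewed as sets *)

Section EvenSets.
Variables (I J : finType) (F : {set I}) (C : {set J}) (a : I -> J -> 'F_2).

Definition null_sets : {set {set I}} :=
  [set D : {set I} | (D \subset F) && [forall j in C, \sum_(i in D) a i j == 0]].

Lemma sum_indicator (D : {set I}) (f : I -> 'F_2) : D \subset F ->
  \sum_(i in F) (i \in D)%:R * f i = \sum_(i in D) f i.
Proof.
move=> DF; rewrite (big_setID D) /= (setIidPr DF) [X in _ + X]big1 ?addr0.
  by apply: eq_bigr => i ->; rewrite mul1r.
by move=> i; rewrite inE => /andP[/negPf-> _]; rewrite mul0r.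
Qed.

Lemma null_setsP (D : {set I}) : reflect
  (D \subset F /\ null F C a (fun i => (i \in D)%:R)) (D \in null_sets).
Proof.
rewrite inE; apply: (iffP andP) => -[DF ND]; split=> //.
  by move=> j jC; rewrite sum_indicator //; apply/eqP/(forall_inP ND).
by apply/forall_inP => j jC; rewrite -sum_indicator // ND.
Qed.

Lemma null_sets0 : set0 \in null_sets.
Proof.
apply/null_setsP; split; first exact: sub0set.
by move=> j _; apply: big1 => i _; rewrite inE mul0r.
Qed.

Lemma null_sets_symdiff (D D' : {set I}) :
  D \in null_sets -> D' \in null_sets -> symdiff D D' \in null_sets.
Proof.
move=> /null_setsP[DF ND] /null_setsP[D'F ND']; apply/null_setsP; split.
  by apply/subsetP => i; rewrite in_symdiff;
    case: (boolP (i \in D)) => [/(subsetP DF)|_ /(subsetP D'F)].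
move=> j jC.
have := congr2 +%R (ND j jC) (ND' j jC); rewrite addr0 -big_split /= => E.
rewrite -[RHS]E; apply: eq_bigr => i _; rewrite -mulrDl in_symdiff; congr (_ * _).
by case: (i \in D); case: (i \in D'); apply: val_inj.
Qed.

(** Taking indicator vectors is a bijection from the null sets to the kernel, as every scalar is 0
    or 1; [rowg] is the set of all vectors in a row space. *)
Lemma card_null_sets :
  #|null_sets| = (2 ^ \rank (kermx (submatrix F C a)))%N.
Proof.
transitivity #|mxabelem.rowg (kermx (submatrix F C a))|; last first.
  by rewrite mxabelem.card_rowg card_Fp.
pose f (D : {set I}) : 'rV['F_2]_#|F| := restr F (fun i => (i \in D)%:R).
have finj : {in null_sets &, injective f}.
  move=> D D' /null_setsP[/subsetP DF _] /null_setsP[/subsetP D'F _] fDD'.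
  apply/setP => i; case: (boolP (i \in F)) => iF.
    by have := restr_inj fDD' iF; case: (_ \in _); case: (_ \in _).
  by rewrite (contraNF (DF i)) // (contraNF (D'F i)).
rewrite -(card_in_imset finj); apply: eq_card => r.
rewrite mxabelem.mem_rowg sub_kermx.
apply/imsetP/eqP => [[D /null_setsP[_ /nullP ND] ->] //|rN].
pose D := [set i in F | extend r i == 1].
have fD : f D = r.
  rewrite -[RHS]extendK; apply/rowP => k.
  by rewrite !mxE inE enum_valP /= -F2P.
exists D => //; apply/null_setsP; split; last by apply/nullP; rewrite -/(f D) fD.
by apply/subsetP => i; rewrite inE => /andP[].
Qed.

(* By duality of linear systems: the all-ones vector on [F] vanishes on the kernel
   iff it is a combination of the columns. *)
Lemma even_null_setsP :
  (forall D : {set I}, D \in null_sets -> ~~ odd #|D|) <->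
  exists s : J -> 'F_2, {in F, forall i, \sum_(j in C) a i j * s j = 1}.
Proof.
split=> [evenZ|[s s1] D /null_setsP[DF ND]].
  pose A := submatrix C F (fun j i => a i j).
  have : ((const_mx 1 : 'rV['F_2]_#|F|) <= A)%MS.
    (* Membership in the row space is tested against the columns of the cokernel. Each such column
       is a null vector, hence the indicator of a null set [D], and its product with the all-ones
       vector is the parity of [#|D|]. *)
    rewrite submxE; apply/eqP/rowP => k; rewrite [RHS]mxE.
    pose x := extend (col k (cokermx A))^T.
    pose D := [set i in F | x i == 1].
    have xD : {in F, forall i, x i = (i \in D)%:R}.
      by move=> i iF; rewrite inE iF /= -F2P.
    have ZD : D \in null_sets.
      apply/null_setsP; split; first by apply/subsetP => i; rewrite inE => /andP[].
      suff : null F C a x.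
        by move=> Nx j jC; rewrite -[RHS](Nx j jC); apply: eq_bigr => i /xD->.
      apply/nullP; rewrite extendK -[RHS]trmxK -[LHS]trmxK; congr (_^T).
      rewrite trmx_mul trmxK trmx0.
      transitivity (A *m col k (cokermx A)); last first.
        by rewrite colE mulmxA mulmx_coker mul0mx.
      congr (_ *m _); by apply/matrixP => i j; rewrite !mxE.
    have := evenZ D ZD; rewrite mxE => evenD.
    transitivity (\sum_(i in F) (i \in D)%:R * 1 : 'F_2).
      rewrite [RHS]big_enum_val; apply: eq_bigr => i _.
      rewrite mxE mul1r mulr1 -xD ?enum_valP //.
      by have /rowP/(_ i) := extendK (col k (cokermx A))^T; rewrite !mxE -/x => ->.
    rewrite sum_indicator; last by case/null_setsP: ZD.
    by rewrite sumr_const natF2_odd (negPf evenD).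
  case/submxP => y yA; exists (extend y) => i iF.
  have /rowP/(_ (enum_rank_in iF i)) := yA; rewrite !mxE => ->.
  rewrite big_enum_val; apply: eq_bigr => j _; rewrite mulrC !mxE enum_rankK_in //.
  by congr (_ * _); have /rowP/(_ j) := extendK y; rewrite mxE.
apply/negP => oddD.
(* The double sum is evaluated in both orders: by rows it is the parity of [#|D|], by columns it
   vanishes. *)
have : \sum_(i in F) (i \in D)%:R * (\sum_(j in C) a i j * s j) = 1.
  rewrite sum_indicator // (eq_bigr (fun=> 1)) => [|i /(subsetP DF)/s1//].
  by rewrite sumr_const natF2_odd oddD.
under eq_bigr do rewrite mulr_sumr.
rewrite exchange_big big1 //= => j jC.
by under eq_bigr do rewrite mulrA; rewrite -mulr_suml ND // mul0r.
Qed.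

End EvenSets.

Lemma ordS_neq n (i : 'I_n) : (1 < n)%N -> ordS i != i.
Proof.
move=> n1; apply/eqP => /(congr1 val) /=.
have := ltn_ord i; rewrite leq_eqVlt => /orP[/eqP ik|ik].
  by rewrite ik modnn => i0; rewrite -ik -i0 in n1.
by rewrite modn_small // => /eqP; rewrite -[X in _ == X]addn0 -addn1 eqn_add2l.
Qed.

Lemma ordS_id n (i : 'I_n) : (n <= 1)%N -> ordS i = i.
Proof. by case: n i => [|[|n]] [[|i] lt] // _; apply: val_inj. Qed.

(** * Cycles are the minimal nonempty even edge sets *)

Section EvenCycles.
Variables (V E : finType) (G : multigraph V E).
Implicit Types (D A : {set E}) (vs : seq V) (es : seq E).

(* Modulo 2 a loop contributes nothing to the degree of its vertex. *)
Definition incidence2 (e : E) (v : V) : 'F_2 :=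
  if #|ends G e| == 2 then (v \in ends G e)%:R else 0.

Definition even_set D : Prop := forall v, \sum_(e in D) incidence2 e v = 0.

Lemma is_cycle_neq0 A : is_cycle G A -> A != set0.
Proof. by case/andP; rewrite card_gt0. Qed.

(** Each edge [e i] has two distinct ends, [v i] and [v (ordS i)]; the terms of the second kind are
    reindexed by the end instead of the edge. The set [D] is general so that both evenness and
    minimality of cycles follow. *)
Lemma cycle_degree A (v : {ffun 'I_#|A| -> V}) (e : {ffun 'I_#|A| -> E}) D x :
  (1 < #|A|)%N -> injective v -> injective e ->
  [set e i | i : 'I_#|A|] = A ->
  (forall i, ends G (e i) = [set v i; v (ordS i)]) -> D \subset A ->
  \sum_(f in D) incidence2 f x =
  \sum_(i | v i == x) ((e i \in D)%:R + (e (ord_pred i) \in D)%:R).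
Proof.
move=> k1 vI eI eA endsE DA.
transitivity (\sum_(f in A) (f \in D)%:R * incidence2 f x).
  by rewrite sum_indicator.
transitivity (\sum_i (e i \in D)%:R * incidence2 (e i) x).
  by rewrite -[in LHS]eA big_imset //= => i j _ _; apply: eI.
transitivity (\sum_i ((v i == x)%:R * (e i \in D)%:R
                      + (v (ordS i) == x)%:R * (e i \in D)%:R) : 'F_2).
  apply: eq_bigr => i _; rewrite -mulrDl mulrC; congr (_ * _).
  rewrite /incidence2 endsE cards2 (inj_eq vI) [i == _]eq_sym ordS_neq //=.
  rewrite !inE ![x == _]eq_sym.
  case: eqVneq => [vx|] /=; last by rewrite add0r.
  by rewrite -vx (inj_eq vI) (negPf (ordS_neq _ _)) // addr0.
rewrite !big_split /=; congr (_ + _).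
  by rewrite [RHS]big_mkcond /=; apply: eq_bigr => i _; case: eqP; rewrite ?mul1r ?mul0r.
rewrite [RHS]big_mkcond [RHS](reindex_inj (@ordS_inj _)) /=.
by apply: eq_bigr => i _; rewrite ordSK; case: eqP; rewrite ?mul1r ?mul0r.
Qed.

(** Length 1 is set apart because there [ordS] is the identity and the edge is a loop, which is
    invisible modulo 2. *)
Lemma cycle_cases A (P : Prop) : is_cycle G A ->
  (forall e, A = [set e] -> #|ends G e| = 1%N -> P) ->
  (forall (v : {ffun 'I_#|A| -> V}) (e : {ffun 'I_#|A| -> E}),
     (1 < #|A|)%N -> injective v -> injective e -> [set e i | i : 'I_#|A|] = A ->
     (forall i, ends G (e i) = [set v i; v (ordS i)]) -> P) -> P.
Proof.
case/andP => A0 /existsP[v /existsP[e /and4P[/injectiveP vI /injectiveP eI /eqP eA]]].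
move=> /forallP endsE loopP longP.
case: (leqP #|A| 1) => [A1|A1]; last first.
  by apply: (longP v e) => // i; apply/eqP.
have /cards1P[f Af] : #|A| == 1%N by rewrite eqn_leq A1.
have [i fi] : exists i, f = e i.
  have : f \in A by rewrite Af set11.
  by rewrite -[X in _ \in pred_of_set X]eA => /imsetP[i _ ->]; exists i.
apply: (loopP f) => //; rewrite fi (eqP (endsE i)).
by rewrite (ordS_id i A1) setUid cards1.
Qed.

Lemma cycle_even A : is_cycle G A -> even_set A.
Proof.
move/cycle_cases; apply=> [e -> loop v|v e A1 vI eI eA endsE x].
  by rewrite big_set1 /incidence2 loop.
rewrite (cycle_degree x A1 vI eI eA endsE (subxx _)) big1 // => i _.
have eiA j : e j \in A by rewrite -[X in _ \in pred_of_set X]eA imset_f.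
by rewrite !eiA addrr_pchar2 // pchar_Fp.
Qed.

(** Exactly two consecutive edges of a longer cycle meet at each of its vertices, so evenness puts
    both or neither in [D]; going round, [D] has all edges or none. *)
Lemma cycle_minimal A D : is_cycle G A -> even_set D -> D \subset A ->
  D != set0 -> D = A.
Proof.
move=> cA evD DA D0; apply/eqP; rewrite eqEsubset DA /=.
apply: (cycle_cases cA) => [e AE _|v e A1 vI eI eA endsE].
  rewrite AE sub1set; case/set0Pn: D0 => f fD.
  by have := subsetP DA f fD; rewrite AE => /set1P <-.
have step i : (e (ordS i) \in D) = (e i \in D).
  have := evD (v (ordS i)); rewrite (cycle_degree _ A1 vI eI eA endsE DA).
  rewrite (big_pred1 (ordS i)) => [|j]; last by rewrite /= (inj_eq vI).
  by rewrite ordSK; case: (e i \in D); case: (e _ \in D).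
have A0 : (0 < #|A|)%N by exact: ltnW.
have all_eq i : (e i \in D) = (e (Ordinal A0) \in D).
  case: i => i; elim: i => [|i IH] lt; first by congr (e _ \in D); apply: val_inj.
  rewrite -(IH (ltnW lt)) -(step (Ordinal (ltnW lt))); congr (e _ \in D).
  apply: val_inj => /=.
  by rewrite modn_small.
have e0D : e (Ordinal A0) \in D.
  case/set0Pn: D0 => f fD; have := subsetP DA f fD; rewrite -[X in _ \in pred_of_set X]eA.
  by case/imsetP => i _ fi; rewrite -(all_eq i) -fi.
rewrite -[X in mem (pred_of_set X) \subset _]eA; apply/subsetP => _ /imsetP[i _ ->].
by rewrite all_eq.
Qed.

Lemma seq_cycle x0 e0 vs es : (0 < size vs)%N -> uniq vs -> uniq es ->
  size es = size vs ->
  (forall i, (i < size vs)%N ->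
    ends G (nth e0 es i) = [set nth x0 vs i; nth x0 vs (i.+1 %% size vs)]) ->
  is_cycle G [set e in es].
Proof.
move=> vs_gt0 uvs ues sz endsE.
have cardE : #|[set e in es]| = size vs by rewrite cardsE (card_uniqP ues).
rewrite /is_cycle cardE vs_gt0 /=.
apply/existsP; exists [ffun i : 'I_(size vs) => nth x0 vs i].
apply/existsP; exists [ffun i : 'I_(size vs) => nth e0 es i].
apply/and4P; split.
- by apply/injectiveP => i j; rewrite !ffunE => /eqP; rewrite nth_uniq // => /eqP/val_inj.
- apply/injectiveP => i j; rewrite !ffunE => /eqP.
  by rewrite nth_uniq ?sz // => /eqP/val_inj.
- apply/eqP/setP => e; rewrite inE; apply/imsetP/idP => [[i _ ->]|/(nthP e0)[i]].
    by rewrite ffunE mem_nth // sz.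
  by rewrite sz => lt <-; exists (Ordinal lt); rewrite ?ffunE.
- by apply/forallP => i; rewrite !ffunE endsE.
Qed.

Lemma loop_cycle e : #|ends G e| = 1%N -> is_cycle G [set e].
Proof.
move/eqP/cards1P => [x ex].
have -> : [set e] = [set f in [:: e]] by apply/setP => f; rewrite !inE.
apply: (@seq_cycle x e [:: x]) => // -[|//] _ /=.
by rewrite ex setUid.
Qed.

(** Since vertices do not repeat, this is a path; [x0] and [e0] are the default values of [nth]. *)
Definition walk D x0 e0 vs es : Prop :=
  [/\ uniq vs, uniq es, size vs = (size es).+1, {subset es <= D}
    & forall i, (i < size es)%N ->
        ends G (nth e0 es i) = [set nth x0 vs i; nth x0 vs i.+1]].

(** If [e] were alone at [x], the degree of [x] in [D] would be 1. *)
Lemma even_next D x e : even_set D -> (forall f, f \in D -> #|ends G f| = 2) ->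
  e \in D -> x \in ends G e -> exists2 f, f \in D & (f != e) && (x \in ends G f).
Proof.
move=> evD loopless eD xe.
case: (pickP [pred f | (f \in D) && ((f != e) && (x \in ends G f))]) => [f /andP[]|none].
  by exists f.
have := evD x; rewrite (bigD1 e) //= big1 => [|f /andP[fD fe]].
  by rewrite /incidence2 loopless // eqxx xe.
by have := none f; rewrite /incidence2 /= fD fe /= => ->; case: ifP.
Qed.

(** Evenness gives another edge [f] at the first vertex of the path. If its other end is new, the
    path grows at the front; if not, [f] closes an initial segment of the path to a cycle. The
    induction is on the number of vertices off the path. *)
Lemma walk_cycle D x0 e0 vs es : even_set D ->
  (forall f, f \in D -> #|ends G f| = 2) -> walk D x0 e0 vs es -> (0 < size es)%N ->
  exists2 A, is_cycle G A & A \subset D.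
Proof.
move=> evD loopless; have [n] := ubnP (#|V| - size vs)%N.
elim: n => // n IH in vs es *; rewrite ltnS => size_n W es_gt0.
have [uvs ues sz esD endsE] := W.
set x := nth x0 vs 0; set e := nth e0 es 0.
have eD : e \in D by rewrite esD // mem_nth.
have xe : x \in ends G e by rewrite endsE // set21.
have [f fD /andP[fe xf]] := even_next evD loopless eD xe.
have [y xy fxy] : exists2 y, x != y & ends G f = [set x; y].
  have /eqP/cards2P[a [c [ac fac]]] := loopless f fD.
  move: xf; rewrite fac => /set2P[]->; first by exists c.
  by exists a; rewrite 1?eq_sym // setUC.
have xvs : x \in vs by rewrite mem_nth // sz.
have ends_vs g : g \in es -> ends G g \subset vs.
  move=> /(nthP e0)[i lt <-]; rewrite endsE //; apply/subsetP => z.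
  by case/set2P => ->; rewrite mem_nth // sz // ltnS ltnW.
case: (boolP (y \in vs)) => yvs; last first.
  apply: (IH (y :: vs) (f :: es)) => //.
    rewrite /= subnS prednK // subn_gt0.
    have uy : uniq (y :: vs) by rewrite /= yvs.
    by rewrite -[(size vs).+1]/(size (y :: vs)) -(card_uniqP uy) max_card.
  split=> //=.
  - by rewrite yvs.
  - rewrite ues andbT; apply: contra yvs => /ends_vs/subsetP; apply.
    by rewrite fxy set22.
  - by rewrite sz.
  - by move=> g; rewrite inE => /orP[/eqP->|/esD].
  - by case=> [_|i /endsE//]; rewrite fxy setUC.
have jlt : (index y vs < size vs)%N by rewrite index_mem.
set j := index y vs in jlt.
have yj : nth x0 vs j = y by exact: nth_index.
have j_gt0 : (0 < j)%N.
  by rewrite lt0n; apply: contraNneq xy => j0; rewrite -yj j0.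
have jes : (j <= size es)%N by rewrite -ltnS -sz.
have szv : size (take j.+1 vs) = j.+1 by rewrite size_take_min (minn_idPl _).
have sze : size (take j es) = j by rewrite size_take_min (minn_idPl _).
exists [set g in rcons (take j es) f]; last first.
  apply/subsetP => g; rewrite inE mem_rcons inE => /orP[/eqP->//|/mem_take].
  exact: esD.
apply: (@seq_cycle x0 e0 (take j.+1 vs)); rewrite ?szv ?take_uniq ?size_rcons ?sze //.
  (* An edge of the path that contains its first vertex is the first edge [e], and [f] differs from
     [e]. *)
  rewrite rcons_uniq take_uniq // andbT; apply/negP => /(nthP e0)[i].
  rewrite sze => ij; rewrite nth_take // => fi.
  have ilt : (i < size es)%N := leq_trans ij jes.
  have fE := endsE i ilt; rewrite fi fxy in fE.
  have i0 : i = 0%N.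
    have : nth x0 vs 0 = nth x0 vs i \/ nth x0 vs 0 = nth x0 vs i.+1.
      by apply/set2P; rewrite -fE set21.
    have vs_gt0 : (0 < size vs)%N by rewrite sz.
    have i1lt : (i.+1 < size vs)%N by rewrite sz ltnS.
    case=> /eqP.
      by rewrite (nth_uniq x0 vs_gt0 (ltnW i1lt) uvs) eq_sym => /eqP.
    by rewrite (nth_uniq x0 vs_gt0 i1lt uvs).
  by rewrite -fi i0 eqxx in fe.
move=> i; rewrite ltnS leq_eqVlt => /orP[/eqP->|ij].
  by rewrite nth_rcons sze ltnn eqxx modnn !nth_take // yj fxy setUC.
rewrite modn_small ?ltnS // !nth_take ?ltnS //; last exact: ltnW.
rewrite nth_rcons sze ij nth_take // endsE //.
exact: leq_trans jes.
Qed.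

(** A loop is a cycle by itself; in the absence of loops any edge of [D] is a path to start from. *)
Lemma even_set_cycle D : even_set D -> D != set0 ->
  exists2 A, is_cycle G A & A \subset D.
Proof.
move=> evD /set0Pn[e eD].
case: (boolP [exists f in D, #|ends G f| == 1%N]) => [|/exists_inPn noloop].
  case/exists_inP => f fD /eqP/loop_cycle cf; exists [set f] => //.
  by rewrite sub1set.
have loopless f : f \in D -> #|ends G f| = 2.
  move=> /noloop; have := card_ends G f.
  by case: #|_| => [|[|[|//]]].
have /eqP/cards2P[x [y [xy exy]]] := loopless e eD.
apply: (@walk_cycle D x e [:: x; y] [:: e]) => //; split=> //=.
- by rewrite inE xy.
- by move=> f; rewrite inE => /eqP->.
- by case.
Qed.

End EvenCycles.

(** * Components of a spanning subgraph *)

Section Components.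
Variables (V E : finType) (G : multigraph V E) (H : {set E}).

Lemma ends_pair e : exists v w, ends G e = [set v; w].
Proof.
have := card_ends G e; case E1: #|ends G e| => [|[|[|//]]] // _.
  by move/eqP/cards1P: E1 => [v ->]; exists v, v; rewrite setUid.
by move/eqP/cards2P: E1 => [v [w [_ ->]]]; exists v, w.
Qed.

Lemma adjacent_sym : symmetric (adjacent G H).
Proof. by move=> v w; rewrite /adjacent setUC. Qed.

Lemma components_partition : partition (components G H) [set: V].
Proof.
apply: equivalence_partitionP => x y z _ _ _; split=> // xy.
by apply: same_connect => //; exact: sym_connect_sym adjacent_sym.
Qed.

Lemma component_class C : C \in components G H ->
  exists x0, C = [set y | connect (adjacent G H) x0 y].
Proof.
case/imsetP => x0 _ ->; exists x0.
by apply/setP => y; rewrite !inE.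
Qed.

Lemma component_closed C e v : C \in components G H -> e \in H -> v \in C ->
  v \in ends G e -> e \in component_edges G H C.
Proof.
move=> /component_class[x0 ->] eH; rewrite !inE eH /= => x0v ve.
apply/subsetP => w we; rewrite inE; apply: connect_trans x0v _.
case: (eqVneq v w) => [->//|vw]; apply: connect1; apply/exists_inP; exists e => //.
rewrite eq_sym eqEcard cards2 vw; have /andP[_ ->] := card_ends G e.
by rewrite andbT; apply/subsetP => u /set2P[]->.
Qed.

(** Connectedness in the form needed for null vectors on vertices, whose value at one end of an edge
    determines the value at the other. *)
Lemma component_ind C : C \in components G H -> exists2 x0, x0 \in C &
  forall P : V -> Prop, P x0 ->
    (forall e v w, e \in component_edges G H C -> ends G e = [set v; w] ->
      P v -> P w) ->
    forall v, v \in C -> P v.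
Proof.
move=> CH; have [x0 CE] := component_class CH.
exists x0 => [|P P0 Pstep v]; first by rewrite CE inE.
rewrite {1}CE inE => /connectP[p pth ->].
have x0C : x0 \in C by rewrite CE inE.
elim: p x0 P0 x0C pth {CE} => //= y p IH x Px xC /andP[/exists_inP[e eH /eqP exy] pth].
have eC : e \in component_edges G H C.
  by apply: (component_closed CH eH xC); rewrite exy set21.
apply: IH pth; first exact: Pstep eC exy Px.
by move: eC; rewrite inE exy subUset !sub1set => /and3P[].
Qed.

Lemma sum_ends (K : fieldType) (C : {set V}) (y : V -> K) e v w :
  ends G e = [set v; w] -> ends G e \subset C ->
  \sum_(x in C) y x * (x \in ends G e)%:R = if v == w then y v else y v + y w.
Proof.
move=> evw eC; rewrite (big_setID (ends G e)) /= (setIidPr eC) [X in _ + X]big1 ?addr0.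
  rewrite (eq_bigr y) => [|x ->]; last by rewrite mulr1.
  rewrite evw; case: eqVneq => [->|vw]; first by rewrite setUid big_set1.
  by rewrite big_setU1 ?inE // big_set1.
by move=> x; rewrite inE => /andP[/negPf-> _]; rewrite mulr0.
Qed.

End Components.

(** * Null spaces of a component over the reals and modulo 2 *)

Section ComponentKernel.
Variables (R : realType) (V E : finType) (G : multigraph V E) (H : {set E}).
Variables (C : {set V}) (CH : C \in components G H).
Let F := component_edges G H C.

Definition incidence (e : E) (v : V) : R := (v \in ends G e)%:R.

Let F_ends e : e \in F -> ends G e \subset C.
Proof. by rewrite inE => /andP[]. Qed.

(** Modulo 2 an edge with two ends makes the values there equal and a loop imposes nothing, so by
    connectedness the null vectors are the constants. *)
Lemma rank_left_kernel2 :
  \rank (kermx (submatrix C F (fun v e => incidence2 G e v))) = 1%N.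
Proof.
have [x0 x0C ind] := component_ind CH.
apply/rank_ker1; exists (fun=> 1); split.
- move=> e eF; have [v [w evw]] := ends_pair G e.
  rewrite /incidence2; case: eqP => [e2|_]; last by apply: big1 => x; rewrite mulr0.
  rewrite (sum_ends _ evw (F_ends eF)); case: eqP => [vw|_].
    by move: e2; rewrite evw vw setUid cards1.
  exact: val_inj.
- by exists x0; rewrite ?oner_eq0.
- move=> y Ny; exists (y x0) => v vC; rewrite mulr1.
  apply: (ind (fun v => y v = y x0)) vC => // e {}v w eF evw yv.
  have := Ny e eF; rewrite /incidence2.
  case: eqP => [_|]; last first.
    by rewrite evw cards2; case: eqVneq => // <-.
  rewrite (sum_ends _ evw (F_ends eF)); case: eqP => [<-//|_].
  by move/eqP; rewrite addr_eq0 oppr_pchar2 ?pchar_Fp // yv => /eqP<-.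
Qed.

(** [s] is a proper 2-colouring: its values differ at the ends of every edge, and a loop, with sum
    0, rules it out. This form is the one produced by [even_null_setsP]. *)
Definition bipartite :=
  exists s : V -> 'F_2, {in F, forall e, \sum_(v in C) incidence2 G e v * s v = 1}.

Lemma bipartite_edge (s : V -> 'F_2) e v w : e \in F -> ends G e = [set v; w] ->
  \sum_(v in C) incidence2 G e v * s v = 1 <-> v != w /\ s v + s w = 1.
Proof.
move=> eF evw; under eq_bigr do rewrite mulrC.
rewrite /incidence2; have -> : (#|ends G e| == 2%N) = (v != w).
  by rewrite evw cards2; case: (v == w).
case: eqVneq => [vw|vw] /=.
  by rewrite big1 => [|x _]; [split=> [/eqP|[]//]|rewrite mulr0].
by rewrite (sum_ends _ evw (F_ends eF)) (negPf vw); split=> [|[]].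
Qed.

Lemma left_null_edge (y : V -> R) e v w : null C F (fun v e => incidence e v) y ->
  e \in F -> ends G e = [set v; w] -> y w = if v == w then 0 else - y v.
Proof.
move=> Ny eF evw; have := Ny e eF; rewrite (sum_ends _ evw (F_ends eF)).
by case: eqP => [<-//|_ /eqP]; rewrite addrC addr_eq0 => /eqP.
Qed.

(** Colours become signs [sg]. Every null vector changes sign along each edge, so it is a multiple
    of [sg]. *)
Lemma rank_left_kernel_bipartite : bipartite ->
  \rank (kermx (submatrix C F (fun v e => incidence e v))) = 1%N.
Proof.
case=> s s1; have [x0 x0C ind] := component_ind CH.
pose sg v : R := if s v == 1 then 1 else -1.
have sgE e v w : e \in F -> ends G e = [set v; w] -> v != w /\ sg w = - sg v.
  move=> eF evw; have [vw svw] := (bipartite_edge s eF evw).1 (s1 e eF).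
  split=> //; move: svw; rewrite [s v]F2P [s w]F2P /sg.
  by case: (s v == 1); case: (s w == 1) => //= _; rewrite ?opprK.
apply/rank_ker1; exists sg; split.
- move=> e eF; have [v [w evw]] := ends_pair G e.
  have [vw sgw] := sgE e v w eF evw.
  by rewrite (sum_ends _ evw (F_ends eF)) (negPf vw) sgw subrr.
- by exists x0 => //; rewrite /sg; case: ifP => _; rewrite ?oppr_eq0 oner_eq0.
(* As [sg x0] is its own inverse, this coefficient gives the right value at [x0]. *)
- move=> y Ny; exists (y x0 * sg x0) => v vC.
  apply: (ind (fun v => y v = y x0 * sg x0 * sg v)) vC => [|e {}v w eF evw yv].
    by rewrite -mulrA /sg; case: ifP; rewrite ?mulrNN !mulr1.
  have [vw sgw] := sgE e v w eF evw.
  by rewrite (left_null_edge Ny eF evw) (negPf vw) yv sgw mulrN.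
Qed.

(** A null vector changes sign along each edge. If zero at one vertex, it is zero on [C]; otherwise
    it vanishes nowhere, which excludes loops, and its signs form a 2-colouring. *)
Lemma rank_left_kernel_nonbipartite : ~ bipartite ->
  \rank (kermx (submatrix C F (fun v e => incidence e v))) = 0%N.
Proof.
move=> nbip; have [x0 x0C ind] := component_ind CH.
apply/rank_ker0 => y Ny.
case: (eqVneq (y x0) 0) => [y0|y0] v vC.
  apply: (ind (fun v => y v = 0)) vC => // e {}v w eF evw yv.
  by rewrite (left_null_edge Ny eF evw) yv oppr0; case: ifP.
case: nbip; exists (fun v => (0 < y v)%R%:R) => e eF.
have [a [c eac]] := ends_pair G e.
have ya : y a != 0.
  have aC : a \in C by rewrite (subsetP (F_ends eF)) // eac set21.
  apply: (ind (fun v => y v != 0)) aC => // f p q fF fpq yp.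
  have := left_null_edge Ny fF fpq; case: eqP => [pq yq|_ ->]; last by rewrite oppr_eq0.
  by rewrite pq yq eqxx in yp.
apply/(bipartite_edge _ eF eac).
have := left_null_edge Ny eF eac; case: eqVneq => [ac yc|ac ->].
  by rewrite ac yc eqxx in ya.
split=> //; rewrite oppr_gt0; case: ltrgt0P ya => // _ _; exact: val_inj.
Qed.

Let cyc := cycles G F.
Let Z := null_sets F C (incidence2 G).

Lemma cycle_spaceP (D : {set E}) : reflect (D \subset F /\ even_set G D) (D \in Z).
Proof.
apply: (iffP (null_setsP _ _ _ _)) => -[DF evD]; split=> // v.
  case: (boolP (v \in C)) => vC; first by rewrite -(sum_indicator _ DF) evD.
  apply: big1 => e eD; rewrite /incidence2; case: ifP => // _.
  have := F_ends (subsetP DF e eD) => /subsetP/(_ v).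
  by case: (v \in ends G e) => // /(_ isT); rewrite (negPf vC).
by move=> _; rewrite sum_indicator.
Qed.

Lemma cycle_space_minimal :
  [/\ {subset cyc <= Z}, set0 \notin cyc,
      forall A D : {set E}, A \in cyc -> D \in Z -> D \subset A -> D != set0 -> D = A
    & forall D : {set E}, D \in Z -> D != set0 -> exists2 A, A \in cyc & A \subset D].
Proof.
split.
- move=> A; rewrite inE => /andP[cA AF]; apply/cycle_spaceP.
  by split=> //; exact: cycle_even.
- by rewrite inE; apply/negP => /andP[/is_cycle_neq0]; rewrite eqxx.
- move=> A D; rewrite inE => /andP[cA _] /cycle_spaceP[_ evD].
  exact: (cycle_minimal cA evD).
- move=> D /cycle_spaceP[DF evD] /(even_set_cycle evD)[A cA AD].
  by exists A => //; rewrite inE cA (subset_trans AD).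
Qed.

Let Z_sd (D D' : {set E}) : D \in Z -> D' \in Z -> symdiff D D' \in Z.
Proof. exact: null_sets_symdiff. Qed.

Let dK := \rank (kermx (submatrix F C incidence)).

(** In the two instances of [rank_nullity] the terms [#|F|] and [#|C|] agree, so the dimensions over
    the two fields differ just as those of the null spaces on vertices do: by 0 if bipartite, by 1
    if not. *)
Lemma nullity_cases :
  ((forall D : {set E}, D \in Z -> ~~ odd #|D|) /\ #|Z| = (2 ^ dK)%N) \/
  ((exists2 D : {set E}, D \in Z & odd #|D|) /\ #|Z| = (2 ^ dK.+1)%N).
Proof.
have dZE := rank_nullity F C (incidence2 G).
rewrite rank_left_kernel2 in dZE.
have dKE := rank_nullity F C incidence.
rewrite /Z card_null_sets.
case: (boolP [exists D in Z, odd #|D|]) => [/exists_inP[D ZD oD]|/exists_inPn ev].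
  right; split; first by exists D.
  rewrite rank_left_kernel_nonbipartite in dKE; last first.
    by move/even_null_setsP/(_ D ZD); rewrite oD.
  congr (2 ^ _)%N; apply/eqP.
  by rewrite -(eqn_add2r #|C|) dZE -[dK.+1]add1n -addnA /dK dKE.
left; split=> //; rewrite rank_left_kernel_bipartite in dKE; last exact/even_null_setsP.
by congr (2 ^ _)%N; apply/eqP; rewrite -(eqn_add2r #|C|) dZE /dK dKE.
Qed.

(** [dK = 0] means that [Z] has one member, or two with one of them odd; [dK = 1] means that it has
    two members, both even, or four with some odd. The counts of minimal members translate this into
    cycles. *)
Lemma nullity01 :
  (dK = 0%N <-> acyclic G F \/ one_cycle_odd G F) /\
  (dK = 1%N <-> [\/ one_cycle_even G F, two_cycles_some_odd G F
                  | one_even_two_odd_sharing G F]).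
Proof.
have [cZ c0 cmin Zc] := cycle_space_minimal; have Z0 := null_sets0 F C (incidence2 G).
have card0 := card_minimal0 Z0 cZ c0 Zc.
have card1 := card_minimal1 Z0 Z_sd cZ c0 Zc.
have cardodd := card_minimal_odd Z0 Z_sd cZ c0 cmin Zc.
have pow2 m n : (2 ^ m = 2 ^ n)%N -> m = n by move/eqP; rewrite eqn_exp2l // => /eqP.
have one_odd : #|cyc| = 1%N -> (exists2 D : {set E}, D \in Z & odd #|D|) ->
    forall D : {set E}, D \in cyc -> odd #|D|.
  move/eqP/cards1P => [A cycA] [D ZD oD] B; rewrite cycA => /set1P->.
  have ZA : Z = [set set0; A] := cyc1_Z Z0 Z_sd cZ c0 Zc cycA.
  move: ZD; rewrite ZA => /set2P[D0|<-//].
  by rewrite D0 cards0 in oD.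
rewrite /acyclic /one_cycle_odd /one_cycle_even /two_cycles_some_odd.
rewrite /one_even_two_odd_sharing /even_cycles /odd_cycles -/cyc.
case: nullity_cases => [[ev ZE]|[oddZ ZE]].
  have evcyc (D : {set E}) : D \in cyc -> ~~ odd #|D| by move/cZ/ev.
  split; split.
  - by move=> dK0; left; apply/card0; rewrite ZE dK0.
  - case=> [/card0|[/eqP/cards1P[A cycA] oddc]]; first by rewrite ZE => /(pow2 _ 0).
    have cA : A \in cyc by rewrite cycA set11.
    by have := evcyc A cA; rewrite oddc.
  - by move=> dK1; constructor 1; split=> //; apply/card1; rewrite ZE dK1.
  - case=> [[/card1]|[_ [D /evcyc/negPf->]]|[_ c2 _]] //.
      by rewrite ZE => /(pow2 _ 1).
    have : (0 < #|[set D in cyc | odd #|D|]|)%N by rewrite c2.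
    by case/card_gt0P => D; rewrite inE => /andP[/evcyc/negPf->].
split; split.
- move=> dK0; right; rewrite dK0 in ZE; have c1 := card1.2 ZE.
  by split=> //; exact: one_odd.
- case=> [/card0|[/card1 + _]]; rewrite ZE; first by move/(pow2 _ 0).
  by move/(pow2 _ 1) => -[].
- move=> dK1; rewrite dK1 in ZE.
  by case: (cardodd.1 (conj ZE oddZ)) => [two|three]; [constructor 2|constructor 3].
- move=> cases; have : #|cyc| = 1%N /\ (forall D, D \in cyc -> ~~ odd #|D|) \/ #|Z| = 4.
    by case: cases => [|two|three]; [left|right; apply: (cardodd.2 _).1; left
                                    |right; apply: (cardodd.2 _).1; right].
  case=> [[c1 ev]|]; last by rewrite ZE => /(pow2 _ 2) [].
  have /eqP/cards1P[A cycA] := c1.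
  have cA : A \in cyc by rewrite cycA set11.
  by have := ev A cA; rewrite (one_odd c1 oddZ A cA).
Qed.

End ComponentKernel.

(** * Decomposition of balanced vectors over the components *)

Section Balanced.
Variables (R : realType) (V E : finType) (G : multigraph V E) (H : {set E}).
Notation vec := {ffun E -> R^o}.

Definition balanced (z : vec) : Prop :=
  (forall e, e \notin H -> z e = 0) /\ (forall v, \sum_(e in delta G v) z e = 0).

Lemma component_exists e : e \in H ->
  exists2 C, C \in components G H & e \in component_edges G H C.
Proof.
move=> eH; have /card_gt0P[v ve] : (0 < #|ends G e|)%N by case/andP: (card_ends G e).
have cov : v \in cover (components G H).
  by rewrite (cover_partition (components_partition G H)) inE.
exists (pblock (components G H) v); first exact: pblock_mem.
by apply: component_closed ve; rewrite ?pblock_mem // mem_pblock.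
Qed.

Lemma component_unique C C' e : C \in components G H -> C' \in components G H ->
  e \in component_edges G H C -> e \in component_edges G H C' -> C = C'.
Proof.
move=> CH C'H; rewrite !inE => /andP[_ /subsetP eC] /andP[_ /subsetP eC'].
have /card_gt0P[v ve] : (0 < #|ends G e|)%N by case/andP: (card_ends G e).
have /and3P[_ /trivIsetP tri _] := components_partition G H.
apply/eqP/negPn/negP => /(tri _ _ CH C'H)/pred0P/(_ v) /=.
by rewrite eC ?eC'.
Qed.

Lemma sum_component C v (z : E -> R) : C \in components G H -> v \in C ->
  (forall e, e \notin H -> z e = 0) ->
  \sum_(e in component_edges G H C) z e * incidence R G e v = \sum_(e in delta G v) z e.
Proof.
move=> CH vC z0; rewrite big_mkcond [RHS]big_mkcond; apply: eq_bigr => e _ /=.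
rewrite /incidence [e \in delta G v]inE.
case: (boolP (v \in ends G e)) => ve /=; last first.
  by rewrite mulr0; case: ifP.
rewrite mulr1; case: ifP => // /negbT eF; rewrite z0 //.
by apply: contra eF => eH; apply: component_closed ve.
Qed.

Lemma balanced_null C (z : vec) : C \in components G H -> balanced z ->
  null (component_edges G H C) C (incidence R G) z.
Proof. by move=> CH [z0 zb] v vC; rewrite sum_component. Qed.

Definition restrict_edges (F : {set E}) (x : E -> R) : vec :=
  [ffun e => if e \in F then x e else 0].

Lemma null_balanced C (x : E -> R) : C \in components G H ->
  null (component_edges G H C) C (incidence R G) x ->
  balanced (restrict_edges (component_edges G H C) x).
Proof.
move=> CH Nx; split=> [e eH|v].
  by rewrite ffunE; case: ifP => //; rewrite inE (negPf eH).
case: (boolP (v \in C)) => vC; last first.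
  apply: big1 => e; rewrite inE => ve; rewrite ffunE; case: ifP => //.
  by rewrite inE => /andP[_ /subsetP/(_ v ve)]; rewrite (negPf vC).
rewrite -(sum_component CH vC) => [|e eH]; last first.
  by rewrite ffunE; case: ifP => //; rewrite inE (negPf eH).
rewrite -[RHS](Nx v vC); apply: eq_bigr => e eF.
by rewrite ffunE eF.
Qed.

(** Restriction to a component preserves balance, so the balanced vectors form a direct sum over
    components; this is a line exactly if one summand is a line and the others vanish. *)
Lemma balanced_line (d : vec) : balanced d -> d != 0 ->
  (forall z, balanced z -> exists c : R, z = c *: d) <->
  exists2 C, C \in components G H &
    (forall C', C' \in components G H -> C' != C ->
      \rank (kermx (submatrix (component_edges G H C') C' (incidence R G))) = 0%N) /\
    \rank (kermx (submatrix (component_edges G H C) C (incidence R G))) = 1%N.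
Proof.
move=> bd d0; split=> [line|[C CH [rk0 /rank_ker1[x [Nx [i iF xi] gen]]]]].
  have [e de] : exists e, d e != 0.
    apply/existsP; apply: contraNT d0 => /existsPn d0; apply/eqP/ffunP => e.
    by rewrite ffunE; apply/eqP/negPn/d0.
  have eH : e \in H by apply: contraNT de => /bd.1 ->.
  have [C CH eC] := component_exists eH; exists C => //.
  (* The restriction of [d] to [C] is a multiple of [d] and agrees with it at [e], where [d] is
     nonzero; so [d] is supported in [C]. *)
  have [c dC] := line _ (null_balanced CH (balanced_null CH bd)).
  have c1 : c = 1.
    have /ffunP/(_ e) := dC; rewrite !ffunE eC => /esym/eqP.
    rewrite -[X in _ == X]mul1r -subr_eq0 -mulrBl mulf_eq0 (negPf de) orbF.
    by rewrite subr_eq0 => /eqP.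
  rewrite c1 scale1r in dC; split=> [C' C'H CC'|].
    apply/rank_ker0 => x /(null_balanced C'H)/line[c' xE] f fC'.
    have /ffunP/(_ f) := xE; rewrite !ffunE fC' => ->.
    rewrite -dC ffunE; case: ifP => fC; last exact: mulr0.
    by rewrite (component_unique C'H CH fC' fC) eqxx in CC'.
  apply/rank_ker1; exists d; split; [exact: balanced_null|by exists e|].
  move=> y /(null_balanced CH)/line[c' yE]; exists c' => f fC.
  by have /ffunP/(_ f) := yE; rewrite !ffunE fC.
have zero_out z f : balanced z -> f \notin component_edges G H C -> z f = 0.
  move=> bz fC; case: (boolP (f \in H)) => [fH|/bz.1//].
  have [C' C'H fC'] := component_exists fH.
  have CC' : C' != C by apply: contraNneq fC => <-.
  by have /rank_ker0 := rk0 C' C'H CC'; apply; first exact: balanced_null.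
have [c dE] := gen _ (balanced_null CH bd).
have c0 : c != 0.
  apply: contraNneq d0 => c0; apply/eqP/ffunP => f; rewrite ffunE.
  case: (boolP (f \in component_edges G H C)) => [/dE->|/zero_out->//].
  by rewrite c0 mul0r.
move=> z bz; have [c' zE] := gen _ (balanced_null CH bz).
exists (c' / c); apply/ffunP => f; rewrite ffunE.
case: (boolP (f \in component_edges G H C)) => fC.
  by rewrite zE // dE // /GRing.scale /= mulrA divfK.
by rewrite !zero_out // /GRing.scale /= mulr0.
Qed.

End Balanced.

(** * Edges of the polytope and lines of balanced vectors *)

Section Edge.
Variables (R : realType) (V E : finType) (G : multigraph V E) (b : V -> R).
Notation vec := {ffun E -> R^o}.
Notation P := (polytope G b).

Definition dot (c x : vec) : R := \sum_e c e * x e.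

Lemma dotD c x y : dot c (x + y) = dot c x + dot c y.
Proof. by rewrite /dot -big_split; apply: eq_bigr => e _; rewrite ffunE mulrDr. Qed.

Lemma dotZ c t x : dot c (t *: x) = t * dot c x.
Proof.
rewrite /dot mulr_sumr; apply: eq_bigr => e _; rewrite ffunE.
exact: mulrCA.
Qed.

Lemma is_vertexP (Q : set vec) u : is_vertex Q u <-> exists c a,
  (forall x, Q x -> dot c x <= a) /\ (forall x, x = u <-> Q x /\ dot c x = a).
Proof.
split=> -[c [a [le_a E0]]]; exists c, a; split=> //.
  by move=> x; have := f_equal (fun A => A x) E0; rewrite /mkset /= => <-.
by apply/seteqP; split=> x /E0.
Qed.

Lemma vertex_mem (Q : set vec) u : is_vertex Q u -> Q u.
Proof. by case/is_vertexP => c [a [_ E0]]; case: ((E0 u).1 erefl). Qed.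

(** The functional exposing [u] is at most [a] at [x] and [y] and averages to [a], so [x] is a
    maximizer too. *)
Lemma vertex_between (Q : set vec) u x y (t : R) : is_vertex Q u -> Q x -> Q y ->
  0 < t < 1 -> u = t *: x + (1 - t) *: y -> x = u.
Proof.
case/is_vertexP => c [a [le_a E0]] Qx Qy /andP[t0 t1] uE.
apply/E0; split=> //; apply/eqP; rewrite eq_le le_a //=.
have [_ cu] := (E0 u).1 erefl; rewrite uE dotD !dotZ in cu.
have := le_a y Qy; nra.
Qed.

Lemma sub_balanced (H : {set E}) x y : P x -> P y ->
  (forall e, e \notin H -> x e = 0 /\ y e = 0) -> balanced G H (x - y).
Proof.
move=> [_ xb] [_ yb] out; split=> [e /out[xe ye]|v].
  by rewrite !ffunE xe ye subr0.
by under eq_bigr do rewrite !ffunE; rewrite sumrB xb yb subrr.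
Qed.

Lemma grP (x : vec) e : P x -> e \notin gr x -> x e = 0.
Proof. by move=> [x0 _]; rewrite inE -leNgt => xe; apply/eqP; rewrite eq_le xe x0. Qed.

Variables (u w : vec).
Hypotheses (uP : is_vertex P u) (wP : is_vertex P w) (uw : u <> w).
Let H := gr u :|: gr w.

Lemma support_out e : e \notin H -> u e = 0 /\ w e = 0.
Proof.
rewrite inE negb_or => /andP[eu ew].
by split; apply: grP => //; apply: vertex_mem.
Qed.

(** The midpoint is positive on all of [H], and [z] vanishes off [H], so short steps both ways stay
    nonnegative. *)
Lemma midpoint_step (z : vec) : balanced G H z -> exists2 eps : R, 0 < eps &
  forall s : R, `|s| <= eps -> P (2^-1 *: (u + w) + s *: z).
Proof.
move=> [z0 zb]; set m := 2^-1 *: (u + w).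
have [u0 ub] := vertex_mem uP; have [w0 wb] := vertex_mem wP.
have mE e : m e = 2^-1 * (u e + w e) by rewrite !ffunE.
have m_gt0 e : e \in H -> 0 < m e.
  rewrite !inE mE => /orP[]; have := u0 e; have := w0 e; lra.
pose del : R := \big[Num.min/1]_(e in H) m e.
have del_gt0 : 0 < del by apply/bigmin_gtP; split=> // e; exact: m_gt0.
have del_le e : e \in H -> del <= m e by move=> eH; exact: bigmin_le_cond.
(* [S] bounds every entry of [z]; the summand 1 makes it positive even for [z = 0]. *)
pose S := 1 + \sum_e `|z e|.
have S_gt0 : 0 < S by rewrite ltr_pwDl // sumr_ge0.
exists (del / S); first exact: divr_gt0.
move=> s; rewrite ler_pdivlMr // => sS; split=> [e|v].
  rewrite [X in 0 <= X]ffunE [X in _ + X]ffunE.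
  case: (boolP (e \in H)) => eH; last first.
    by rewrite z0 // mE /GRing.scale /= mulr0; have := u0 e; have := w0 e; lra.
  have ze : `|z e| <= S.
    by rewrite /S (bigD1 e) //= addrCA lerDl addr_ge0 // sumr_ge0.
  have : `|s * z e| <= del.
    by rewrite normrM (le_trans _ sS) // ler_wpM2l.
  rewrite ler_norml => /andP[ge_del _].
  by have := del_le e eH; rewrite /GRing.scale /=; lra.
have -> : \sum_(e in delta G v) (m + s *: z) e =
    2^-1 * (\sum_(e in delta G v) u e + \sum_(e in delta G v) w e)
    + s * \sum_(e in delta G v) z e.
  rewrite -big_split !mulr_sumr -big_split; apply: eq_bigr => e _.
  by rewrite !ffunE.
by rewrite ub wb zb; lra.
Qed.

Lemma edge_line : vertices_of_edge P u w <->
  forall z, balanced G H z -> exists c : R, z = c *: (u - w).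
Proof.
have d0 : u - w != 0 by rewrite subr_eq0; apply/eqP.
split=> [[F [[c [a [le_a FE]]] [_ [U [Usub _ dimU]]]] vert]|line].
  have Fu : F u by apply: vertex_mem; apply/vert; left.
  have Fw : F w by apply: vertex_mem; apply/vert; right.
  move=> z bz; have [eps eps_gt0 stepP] := midpoint_step bz.
  set m := 2^-1 *: (u + w) in stepP.
  have FP x : F x <-> P x /\ dot c x = a by rewrite FE.
  have [_ cu] := (FP u).1 Fu; have [_ cw] := (FP w).1 Fw.
  have cm : dot c m = a by rewrite dotZ dotD cu cw; lra.
  have dotm s : dot c (m + s *: z) = a + s * dot c z.
    by rewrite (dotD c m) (dotZ c s z) cm.
  (* Steps along [z] and [- z] from a maximizer stay in the polytope, so the functional can grow in
     neither direction. *)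
  have cz : dot c z = 0.
    have P1 : P (m + eps *: z) by apply: stepP; rewrite gtr0_norm.
    have P2 : P (m + (- eps) *: z) by apply: stepP; rewrite normrN gtr0_norm.
    have := le_a _ P1; have := le_a _ P2; rewrite -!/(dot _ _) !dotm; nra.
  have Fm s : `|s| <= eps -> F (m + s *: z).
    by move=> s_le; apply/FP; rewrite dotm cz mulr0 addr0; split=> //; exact: stepP.
  have zU : z \in U.
    have Fm0 : F m by have := Fm 0; rewrite scale0r addr0 normr0; apply; exact: ltW.
    have Fm1 : F (m + eps *: z) by apply: Fm; rewrite gtr0_norm.
    have := memvZ eps^-1 (Usub _ _ Fm1 Fm0).
    by rewrite addrAC subrr add0r scalerA mulVf ?gt_eqF // scale1r.
  have UE : <[u - w]>%VS = U.
    by apply/eqP; rewrite eqEdim dimU dim_vline d0 andbT -memvE Usub.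
  by move: zU; rewrite -UE => /vlineP[k ->]; exists k.
(* Minus the total weight off [H] is at most 0 on the polytope, with equality exactly for the points
   supported in [H]. *)
pose F : set vec := [set x | P x /\ dot [ffun e => - (e \notin H)%:R] x = 0]%classic.
have dotE x : dot [ffun e => - (e \notin H)%:R] x = - \sum_(e | e \notin H) x e.
  rewrite /dot [in RHS]big_mkcond -sumrN; apply: eq_bigr => e _; rewrite ffunE.
  by case: (e \notin H) => /=; rewrite ?mulN1r ?oppr0 ?mul0r.
have FP x : F x <-> P x /\ forall e, e \notin H -> x e = 0.
  split=> -[Px x0]; split=> //; last by rewrite dotE big1 ?oppr0.
  move: x0; rewrite dotE => /eqP; rewrite oppr_eq0 psumr_eq0 => [|e _]; last exact: Px.1.
  move=> /allP x0 e eH.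
  by apply/eqP; have := x0 e (mem_index_enum e); rewrite eH.
have Fu : F u by apply/FP; split=> [|e /support_out[]//]; exact: vertex_mem.
have Fw : F w by apply/FP; split=> [|e /support_out[]//]; exact: vertex_mem.
have Fdiff x y : F x -> F y -> balanced G H (x - y).
  by move=> /FP[Px x0] /FP[Py y0]; apply: sub_balanced => // e eH; rewrite x0 ?y0.
have sub_vertex v : F v -> is_vertex P v -> is_vertex F v.
  move=> Fv /is_vertexP[c [a [le_a E0]]]; apply/is_vertexP; exists c, a.
  split=> [x /FP[Px _]|x]; first exact: le_a.
  split=> [->|[/FP[Px _] cx]]; last exact/E0.
  by have [_] := (E0 v).1 erefl.
exists F; last first.
  move=> x; split=> [vx|[]->]; [|exact: sub_vertex|exact: sub_vertex].
  have Fx := vertex_mem vx.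
  have [t xt] := line _ (Fdiff x w Fx Fw).
  have xE e : x e = t * u e + (1 - t) * w e.
    by have /ffunP/(_ e) := xt; rewrite !ffunE /GRing.scale /=; lra.
  have [Px _] := (FP x).1 Fx; have [Pu Pw] := (vertex_mem uP, vertex_mem wP).
  (* On the line through [u] and [w], if the three points are distinct then one lies strictly
     between the other two; being a vertex, it must by [vertex_between] coincide with one of
     them. *)
  have [t0|t0|t0] := ltrgt0P t; last first.
  - by right; apply/ffunP => e; rewrite xE t0; lra.
  - right; have s_gt0 : 0 < 1 - t by lra.
    apply: (@vertex_between P w x u (1 - t)^-1) => //.
      by rewrite invr_gt0 s_gt0 invf_lt1 //; lra.
    apply/ffunP => e; rewrite !ffunE /GRing.scale /= xE; field.
    exact: lt0r_neq0.
  left; have [t1|t1|t1] := ltrgtP t 1; last first.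
  - by apply/ffunP => e; rewrite xE t1; lra.
  - apply: (@vertex_between P u x w t^-1) => //.
      by rewrite invr_gt0 t0 invf_lt1.
    apply/ffunP => e; rewrite !ffunE /GRing.scale /= xE; field.
    exact: lt0r_neq0.
  - apply/esym/(@vertex_between F x u w t) => //; first by rewrite t0.
    by apply/ffunP => e; rewrite !ffunE /GRing.scale /= xE.
split.
  exists [ffun e => - (e \notin H)%:R], 0; split=> // x Px.
  rewrite -/(dot _ _) dotE oppr_le0 sumr_ge0 // => e _; exact: Px.1.
split; first by exists u.
exists <[u - w]>%VS; split.
- move=> x y Fx Fy; have [t ->] := line _ (Fdiff x y Fx Fy).
  by rewrite memvZ // memv_line.
- by move=> W FW; rewrite -memvE; exact: FW.
- by rewrite dim_vline d0.
Qed.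

End Edge.

(** * Adjacency of vertices in terms of cycles *)

Theorem theorem25 (R : realType) (V E : finType) (G : multigraph V E)
    (b : V -> R) (u w : {ffun E -> R^o})
    (V_nonempty : (0 < #|V|)%N) (b_ge0 : forall v, 0 <= b v)
    (u_vertex : is_vertex (polytope G b) u)
    (w_vertex : is_vertex (polytope G b) w)
    (u_neq_w : u <> w) :
  vertices_of_edge (polytope G b) u w <->
  exists2 C : {set V}, C \in components G (gr u :|: gr w) &
    (forall C' : {set V}, C' \in components G (gr u :|: gr w) -> C' != C ->
       acyclic G (component_edges G (gr u :|: gr w) C') \/
       one_cycle_odd G (component_edges G (gr u :|: gr w) C')) /\
    [\/ one_cycle_even G (component_edges G (gr u :|: gr w) C),
        two_cycles_some_odd G (component_edges G (gr u :|: gr w) C)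
      | one_even_two_odd_sharing G (component_edges G (gr u :|: gr w) C)].
Proof.
have ? : u - w != 0 by rewrite subr_eq0; apply/eqP.
have bal : balanced G (gr u :|: gr w) (u - w).
  apply: (@sub_balanced _ _ _ _ b); [exact: vertex_mem|exact: vertex_mem|].
  exact: support_out u_vertex w_vertex.
apply: (iff_trans (edge_line u_vertex w_vertex u_neq_w)).
apply: (iff_trans (balanced_line bal _)) => //.
split=> -[C CH [other this]]; exists C => //; split=> [C' C'H CC'|].
- exact/(nullity01 R C'H).1/other.
- exact/(nullity01 R CH).2.
- exact/(nullity01 R C'H).1/other.
- exact/(nullity01 R CH).2.
Qed.
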